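(* Let $S$ be a 3- or 4-dimensional Sklyanin algebra over $\mathbb{C}$ corresponding to a finite order automorphism $\sigma$ of an elliptic curve $E$. Let $\mathrm{tr}_{\mathrm{red}}:S\to\mathcal{Z}(S)$ be the reduced trace map, and let $(S,\mathcal{Z}(S),\partial_{\mathrm{sp}})$ be the Poisson order structure constructed by Walton, Wang and Yakimov by obtaining $S$ as a higher order specialization. Then $(S,\mathcal{Z}(S),\partial_{\mathrm{sp}},\mathrm{tr}_{\mathrm{red}})$ is a Poisson trace order.
   Context: The 3-dimensional Sklyanin algebras are the $\mathbb{C}$-algebras generated by $x,y,z$ subject to $ayz+bzy+cx^2=azx+bxz+cy^2=axy+byx+cz^2=0$ with $a,b,c\in\mathbb{C}$, $abc\ne0$, $(3abc)^3\ne(a^3+b^3+c^3)^3$. The 4-dimensional Sklyanin algebras are the $\mathbb{C}$-algebras generated by $x_0,x_1,x_2,x_3$ subject to $x_0x_1-x_1x_0=\alpha(x_2x_3+x_3x_2)$, $x_0x_1+x_1x_0=x_2x_3-x_3x_2$, $x_0x_2-x_2x_0=\beta(x_3x_1+x_1x_3)$, $x_0x_2+x_2x_0=x_3x_1-x_1x_3$, $x_0x_3-x_3x_0=\gamma(x_1x_2+x_2x_1)$, $x_0x_3+x_3x_0=x_1x_2-x_2x_1$, with $\alpha,\beta,\gamma\in\mathbb{C}$, $\alpha+\beta+\gamma+\alpha\beta\gamma=0$ and $(\alpha,\beta),(\beta,\gamma),(\gamma,\alpha)\ne(-1,1)$. To each such $S$ one associates (Artin–Schelter, Artin–Tate–van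 den Bergh, Smith–Stafford) an elliptic curve $E$, an automorphism $\sigma$ of $E$ and an invertible sheaf on $E$; the following are known to be equivalent: $\sigma$ has finite order; $S$ is a PI algebra; $S$ is module finite over its center $\mathcal{Z}(S)$. In this case $S$ is known to be a maximal order, so $\mathcal{Z}(S)$ is normal and the reduced trace below is defined. Poisson order (over $\mathbb{C}$): $(R,C,\partial)$ with $C$ a central subalgebra of $R$ over which $R$ is a finitely generated module, $C$ a Poisson algebra with bracket $\{.,.\}$, and $\partial:C\to\mathrm{Der}_{\mathbb{C}}(R)$ a $\mathbb{C}$-linear map with $\partial_c|_C=\{c,-\}$. Poisson trace order: $(R,C,\partial,\mathrm{tr})$ with $(R,C,\partial)$ a Poisson order and $\mathrm{tr}:R\to C$ a $C$-linear map with $\mathrm{tr}(xy)=\mathrm{tr}(yx)$ for all $x,y\in R$ and $\mathrm{tr}(\partial_c(r))=\{c,\mathrm{tr}(r)\}$ for all $c\in C$, $r\in R$. The Poisson order $(S,\mathcal{Z}(S),\partial_{\mathrm{sp}})$: Walton, Wang and Yakimov (in their two works on the Poisson geometry of PI 3-dimensional and of PI 4-dimensional Sklyanin algebras) realized each 3- and 4-dimensional PI Sklyanin algebra $S$ as a higher order specialization, meaning that they constructed a $\mathbb{C}$-algebra $T$ with a central non-zero-divisor $\hbar\in T$ and $T/\hbar T\cong S$, with projection $\theta:T\to S$, a positive integer $N$, and a linear map $\iota:\mathcal{Z}(S)\to T$ with $\theta\iota=\mathrm{id}$ and $[\iota(c),y]\in\hbar^NT$ for all $c\in\mathcal{Z}(S)$,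 $y\in T$. The Poisson order is given, for their specific choice of these data, by $(\partial_{\mathrm{sp}})_c(\theta(y))=\theta\big(\hbar^{-N}[\iota(c),y]\big)$ for $c\in\mathcal{Z}(S)$, $y\in T$, with Poisson bracket $\{c,c'\}=(\partial_{\mathrm{sp}})_c(c')$ on $\mathcal{Z}(S)$. They proved that these Poisson order structures are nontrivial. Reduced trace: for $R$ prime, finite over its center $\mathcal{Z}(R)$ with $\mathcal{Z}(R)$ normal with fraction field $Q$, choose a finite extension $F/Q$ with $R\otimes_{\mathcal{Z}(R)}F\cong M_n(F)$; $\mathrm{tr}_{\mathrm{red}}:R\to\mathcal{Z}(R)$ is $r\mapsto$ matrix trace of $r\otimes1$ (it takes values in $\mathcal{Z}(R)$). *)

(* Defs.v *)
From HB Require Import structures.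
From mathcomp Require Import all_boot all_order all_algebra all_field.
From mathcomp Require Import boolp reals.
From mathcomp Require Export complex.

Set Implicit Arguments.
Unset Strict Implicit.
Unset Printing Implicit Defensive.

Import GRing.Theory.
Local Open Scope ring_scope.

Section Center.
Variables (k : fieldType) (A : algType k).

Definition in_center : {pred A} := [pred z : A | `[< forall y, z * y = y * z >]].

Lemma in_centerP (z : A) :
  reflect (forall y, z * y = y * z) (z \in in_center).
Proof. exact: asboolP. Qed.

Fact center_subalg_closed : subalg_closed in_center.
Proof.
split; first by apply/in_centerP => y; rewrite mul1r mulr1.
- move=> a u v /in_centerP hu /in_centerP hv; apply/in_centerP => y.
  by rewrite mulrDl mulrDr -scalerAl -scalerAr hu hv.
- move=> u v /in_centerP hu /in_centerP hv; apply/in_centerP => y.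
  by rewrite -mulrA hv mulrA hu mulrA.
Qed.

HB.instance Definition _ :=
  GRing.isSubalgClosed.Build k A in_center center_subalg_closed.

Definition center : Type := {z : A | z \in in_center}.

HB.instance Definition _ := SubChoice.on center.
HB.instance Definition _ := [SubChoice_isSubAlgebra of center by <:].

Fact center_mulrC : commutative (@GRing.mul center).
Proof. by move=> z w; apply: val_inj; apply/in_centerP/(valP z). Qed.

HB.instance Definition _ :=
  GRing.PzRing_hasCommutativeMul.Build center center_mulrC.

End Center.

Section PoissonOrders.
Variable k : fieldType.

Definition is_derivation (A : algType k) (d : A -> A) : Prop :=
  (forall (a : k) (x y : A), d (a *: x + y) = a *: d x + d y) /\
  (forall x y : A, d (x * y) = d x * y + x * d y).

Definition is_poisson_bracket (C : algType k) (br : C -> C -> C) : Prop :=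
  [/\ forall c, is_derivation (br c),
      forall (a : k) (c d e : C), br (a *: c + d) e = a *: br c e + br d e,
      forall c, br c c = 0
    & forall c d e, br c (br d e) + br d (br e c) + br e (br c d) = 0].

Variables (A : algType k) (P : pred A) (C : subAlgType P).

Definition is_poisson_order (br : C -> C -> C) (der : C -> A -> A) : Prop :=
  [/\ forall (c : C) (r : A), val c * r = r * val c,
      exists (n : nat) (g : 'I_n -> A),
        forall r : A, exists c : 'I_n -> C, r = \sum_i val (c i) * g i,
      is_poisson_bracket br,
      (forall c, is_derivation (der c)) /\
      (forall (a : k) (c d : C) (r : A),
         der (a *: c + d) r = a *: der c r + der d r)
    & forall c d : C, der c (val d) = val (br c d)].

Definition is_poisson_trace_order
    (br : C -> C -> C) (der : C -> A -> A) (tr : A -> C) : Prop :=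
  [/\ is_poisson_order br der,
      forall (c : C) (r s : A), tr (val c * r + s) = c * tr r + tr s,
      forall r s : A, tr (r * s) = tr (s * r)
    & forall (c : C) (r : A), tr (der c r) = br c (tr r)].

End PoissonOrders.

Record specialization (k : fieldType) (S : algType k) := Specialization {
  sp_alg :> algType k;
  sp_hbar : sp_alg;
  sp_theta : {lrmorphism sp_alg -> S};
  sp_level : nat;
  sp_iota : {linear center S -> sp_alg};
  sp_hbar_central : forall t, sp_hbar * t = t * sp_hbar;
  sp_hbar_regular : forall t, sp_hbar * t = 0 -> t = 0;
  sp_theta_surj : forall s, exists t, sp_theta t = s;
  sp_theta_ker : forall t, sp_theta t = 0 <-> exists u, t = sp_hbar * u;
  sp_level_gt0 : (0 < sp_level)%N;
  sp_iotaK : forall c, sp_theta (sp_iota c) = val c;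
  sp_comm : forall c y, exists w,
    sp_iota c * y - y * sp_iota c = sp_hbar ^+ sp_level * w
}.

Section SpecializationDerivation.
Variables (k : fieldType) (S : algType k) (T : specialization S).

(* hbar^-N [iota c, y]; see [sp_quotE]. *)
Definition sp_quot (c : center S) (y : T) : T := sval (cid (sp_comm c y)).

(* theta(y) |-> theta(hbar^-N [iota c, y]), computed with a chosen preimage;
   [sp_derE] shows that the choice is irrelevant. *)
Definition sp_der (c : center S) (s : S) : S :=
  sp_theta T (sp_quot c (sval (cid (sp_theta_surj T s)))).

(* The value lies in the center by [val_sp_bracket]: the default is not used. *)
Definition sp_bracket (c d : center S) : center S :=
  insubd 0 (sp_der c (val d)).

Lemma sp_quotE c y :
  sp_hbar T ^+ sp_level T * sp_quot c y = sp_iota T c * y - y * sp_iota T c.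
Proof. by rewrite /sp_quot; case: cid. Qed.

Lemma sp_hbarX_central n (t : T) : sp_hbar T ^+ n * t = t * sp_hbar T ^+ n.
Proof.
by apply/commr_sym/commrX; rewrite /GRing.comm sp_hbar_central.
Qed.

Lemma sp_hbarX_inj n : injective ( *%R (sp_hbar T ^+ n)).
Proof.
move=> t u /eqP; rewrite -subr_eq0 -mulrBr => /eqP h.
apply/eqP; rewrite -subr_eq0; apply/eqP; move: h.
elim: n (t - u) => [|n IHn] v; first by rewrite mul1r.
by rewrite exprS -mulrA => /sp_hbar_regular/IHn.
Qed.

Lemma sp_derE c y : sp_der c (sp_theta T y) = sp_theta T (sp_quot c y).
Proof.
rewrite /sp_der; case: cid => y' /= hy'.
have /sp_theta_ker[u hu] : sp_theta T (y' - y) = 0.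
  by rewrite raddfB /= hy' subrr.
have -> : sp_quot c y' = sp_quot c y + sp_hbar T * sp_quot c u.
  apply: (@sp_hbarX_inj (sp_level T)).
  rewrite mulrDr mulrA -exprSr exprS -mulrA !sp_quotE.
  have -> : y' = sp_hbar T * u + y by rewrite -hu subrK.
  rewrite mulrBr mulrDr mulrDl !mulrA -(sp_hbar_central (sp_iota T c)).
  by rewrite opprD addrACA addrC.
have h0 : sp_theta T (sp_hbar T) = 0.
  by apply/sp_theta_ker; exists 1; rewrite mulr1.
by rewrite raddfD /= rmorphM /= h0 mul0r addr0.
Qed.

Lemma val_sp_bracket c d : val (sp_bracket c d) = sp_der c (val d).
Proof.
rewrite /sp_bracket val_insubd ifT //; apply/in_centerP => s.
have [y hy] := sp_theta_surj T (val d); have [u hu] := sp_theta_surj T s.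
rewrite -hy sp_derE -hu -!rmorphM /=.
set w := sp_quot c y; set v := sp_quot c u.
have /sp_theta_ker[p hp] : sp_theta T (y * u - u * y) = 0.
  rewrite raddfB /= !rmorphM /= hy (in_centerP _ _) ?subrr //; exact: (valP d).
have h0 : sp_theta T (sp_hbar T) = 0.
  by apply/sp_theta_ker; exists 1; rewrite mulr1.
set q := sp_quot c p.
apply/eqP; rewrite -subr_eq0 -raddfB.
have -> : w * u - u * w = sp_hbar T * q - (y * v - v * y).
  apply: (@sp_hbarX_inj (sp_level T)).
  rewrite !mulrBr ![_ ^+ _ * (_ * _)]mulrA sp_quotE -exprSr exprS.
  rewrite -[_ * _ * q]mulrA sp_quotE mulrBr sp_quotE.
  rewrite [_ ^+ _ * u]sp_hbarX_central [_ ^+ _ * y]sp_hbarX_central.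
  rewrite -[u * _ * w]mulrA -[y * _ * v]mulrA !sp_quotE !mulrA.
  rewrite (sp_hbar_central (sp_iota T c)) -[_ * sp_hbar T * p]mulrA -hp.
  rewrite !(mulrBr, mulrBl) !mulrA.
  move: (sp_iota T c) => i; rewrite !opprB.
  by rewrite !addrA [RHS](ACl ((1*8*3*6)*(5*2)*(7*4)))/= !subrr !addr0.
by rewrite !raddfB /= !rmorphM /= h0 mul0r hy (in_centerP _ (valP d)) opprK addNr addr0.
Qed.

End SpecializationDerivation.

Definition is_prime_ring (A : nzRingType) : Prop :=
  forall a b : A, (forall r, a * r * b = 0) -> a = 0 \/ b = 0.

Definition is_fraction_field (Z : comNzRingType) (Q : fieldType)
    (q : {rmorphism Z -> Q}) : Prop :=
  injective q /\ forall u : Q, exists a b : Z, b != 0 /\ u = q a / q b.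

Definition is_normal_in (Z : comNzRingType) (Q : fieldType)
    (q : {rmorphism Z -> Q}) : Prop :=
  forall u : Q, integralOver q u -> exists z : Z, u = q z.

Section TensorProduct.
(* [Z] acts on the right of [M] by [actM] and on the left of [N] by [actN]. *)
Variables (Z : Type) (M N : zmodType) (actM : Z -> M -> M) (actN : Z -> N -> N).

Definition is_balanced (V : zmodType) (b : M -> N -> V) : Prop :=
  [/\ forall m m' n, b (m + m') n = b m n + b m' n,
      forall m n n', b m (n + n') = b m n + b m n'
    & forall z m n, b (actM z m) n = b m (actN z n)].

Definition is_tensor_product (V : zmodType) (t : M -> N -> V) : Prop :=
  is_balanced t /\
  forall (W : zmodType) (b : M -> N -> W), is_balanced b ->
    exists g : {additive V -> W},
      (forall m n, g (t m n) = b m n) /\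
      forall g' : {additive V -> W}, (forall m n, g' (t m n) = b m n) -> g' =1 g.
End TensorProduct.

Section ReducedTrace.
Variables (k : fieldType) (A : algType k).
Local Notation Z := (center A).

Definition is_finite_over_center : Prop :=
  exists (n : nat) (g : 'I_n -> A),
    forall r : A, exists c : 'I_n -> Z, r = \sum_i val (c i) * g i.

(* [phi] is r |-> r (x) 1 followed by an isomorphism of F-algebras from
   A (x)_Z F to M_(n+1)(F). *)
Definition is_splitting (Q : fieldType) (q : {rmorphism Z -> Q})
    (F : fieldExtType Q) (n : nat) (phi : {rmorphism A -> 'M[F]_n.+1}) : Prop :=
  is_tensor_product (fun (z : Z) (r : A) => val z * r)
                    (fun (z : Z) (f : F) => q z *: f)
                    (fun (r : A) (f : F) => f *: phi r).

(* The reduced trace is defined when A is prime and module-finite over a normal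
   center; these conditions are part of the definition. *)
Definition is_reduced_trace (tr : A -> Z) : Prop :=
  [/\ is_prime_ring A,
      is_finite_over_center
    & exists (Q : fieldType) (q : {rmorphism Z -> Q}),
      [/\ is_fraction_field q,
          is_normal_in q
        & exists (F : fieldExtType Q) (n : nat) (phi : {rmorphism A -> 'M[F]_n.+1}),
            is_splitting q phi /\ forall r : A, (q (tr r))%:A = \tr (phi r)]].
End ReducedTrace.

Section Quadratic.
Variables (k : fieldType) (n : nat).

(* A system of quadratic relations, as a condition on the products
   [m i j] = x_i x_j; the values [m i j] = p_i q_j give its multilinearization. *)
Definition quadratic_system :=
  forall V : lmodType k, ('I_n -> 'I_n -> V) -> Prop.

Variable rel : quadratic_system.

Definition satisfies (A : algType k) (x : 'I_n -> A) : Prop :=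
  rel (fun i j => x i * x j).

(* [A] is the k-algebra generated by the x_i subject to [rel]. *)
Definition is_presented (A : algType k) (x : 'I_n -> A) : Prop :=
  satisfies x /\
  forall (B : algType k) (y : 'I_n -> B), satisfies y ->
    exists f : {lrmorphism A -> B},
      (forall i, f (x i) = y i) /\
      forall g : {lrmorphism A -> B}, (forall i, g (x i) = y i) -> g =1 f.

(* Points of projective space are nonzero row vectors up to [proj_eq]. *)
Definition proj_eq (p q : 'rV[k]_n) : Prop :=
  exists2 l : k, l != 0 & p = l *: q.

Definition point_scheme (p q : 'rV[k]_n) : Prop :=
  [/\ p != 0, q != 0 & rel (V := k^o) (fun i j => p 0 i * q 0 j)].

(* [s] is the automorphism of [E] whose graph is the part of the point scheme
   lying in E x E. *)
Definition is_point_automorphism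
    (E : 'rV[k]_n -> Prop) (s : 'rV[k]_n -> 'rV[k]_n) : Prop :=
  [/\ forall p, E p -> E (s p),
      forall q, E q -> exists2 p, E p & proj_eq (s p) q,
      forall p p', E p -> E p' -> proj_eq (s p) (s p') -> proj_eq p p'
    & forall p q, E p -> E q -> (point_scheme p q <-> proj_eq q (s p))].

Definition has_finite_order
    (E : 'rV[k]_n -> Prop) (s : 'rV[k]_n -> 'rV[k]_n) : Prop :=
  exists2 m : nat, (0 < m)%N & forall p, E p -> proj_eq (iter m s p) p.

End Quadratic.

Section Sklyanin.
Variable k : fieldType.

Section Dimension3.
Variables a b c : k.

Definition sklyanin3_params : Prop :=
  a * b * c != 0 /\
  (3 * a * b * c) ^+ 3 != (a ^+ 3 + b ^+ 3 + c ^+ 3) ^+ 3.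

Definition sklyanin3_rel : quadratic_system k 3 := fun V m =>
  [/\ a *: m 1 2 + b *: m 2 1 + c *: m 0 0 = 0,
      a *: m 2 0 + b *: m 0 2 + c *: m 1 1 = 0
    & a *: m 0 1 + b *: m 1 0 + c *: m 2 2 = 0].

(* The cubic is the determinant of the multilinearized relations, seen as a
   linear system in the second point: its zeros are the first projection of the
   point scheme. *)
Definition sklyanin3_curve (p : 'rV[k]_3) : Prop :=
  p != 0 /\
  (a ^+ 3 + b ^+ 3 + c ^+ 3) * (p 0 0 * p 0 1 * p 0 2) =
  a * b * c * (p 0 0 ^+ 3 + p 0 1 ^+ 3 + p 0 2 ^+ 3).

End Dimension3.

Section Dimension4.
Variables alpha beta gamma : k.

Definition sklyanin4_params : Prop :=
  [/\ alpha + beta + gamma + alpha * beta * gamma = 0,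
      (alpha, beta) != (-1, 1), (beta, gamma) != (-1, 1)
    & (gamma, alpha) != (-1, 1)].

Definition sklyanin4_rel : quadratic_system k 4 := fun V m =>
  [/\ m 0 1 - m 1 0 = alpha *: (m 2 3 + m 3 2) /\
      m 0 1 + m 1 0 = m 2 3 - m 3 2,
      m 0 2 - m 2 0 = beta *: (m 3 1 + m 1 3) /\
      m 0 2 + m 2 0 = m 3 1 - m 1 3
    & m 0 3 - m 3 0 = gamma *: (m 1 2 + m 2 1) /\
      m 0 3 + m 3 0 = m 1 2 - m 2 1].

(* The point variety is the union of E and the four coordinate points, which are
   fixed. For alpha * beta * gamma != 0, alpha != -1 and beta != 1, the curve E is
     x0^2 + x1^2 + x2^2 + x3^2 = 0,
     (1-gamma)/(1+alpha) x1^2 + (1+gamma)/(1-beta) x2^2 + x3^2 = 0. *)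
Definition sklyanin4_curve (p : 'rV[k]_4) : Prop :=
  (exists q, point_scheme sklyanin4_rel p q) /\
  ~ exists i : 'I_4, proj_eq p (delta_mx 0 i).

End Dimension4.

Definition sklyanin3_finite_order (S : algType k) : Prop :=
  exists (a b c : k) (x : 'I_3 -> S) (sigma : 'rV[k]_3 -> 'rV[k]_3),
    [/\ sklyanin3_params a b c,
        is_presented (sklyanin3_rel a b c) x,
        is_point_automorphism (sklyanin3_rel a b c) (sklyanin3_curve a b c) sigma
      & has_finite_order (sklyanin3_curve a b c) sigma].

Definition sklyanin4_finite_order (S : algType k) : Prop :=
  exists (al be ga : k) (x : 'I_4 -> S) (sigma : 'rV[k]_4 -> 'rV[k]_4),
    [/\ sklyanin4_params al be ga,
        is_presented (sklyanin4_rel al be ga) x,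
        is_point_automorphism (sklyanin4_rel al be ga)
          (sklyanin4_curve al be ga) sigma
      & has_finite_order (sklyanin4_curve al be ga) sigma].

End Sklyanin.

(* Main.v *)
(** In characteristic 0 the reduced trace commutes with every derivation delta
    preserving the center Z, because n times the reduced trace is the trace of
    the regular representation. Take a maximal Z-independent column g of elements
    of A and a nonzero z in Z with [z r g = M g], [z delta(g) = D g] and
    [z delta(r) g = N g] for matrices over Z. Applying delta to the first
    identity gives [delta(z) M + z N + D M = z delta(M) + M D]; the commutator
    of M and D disappears under the trace, and [z^2 n] cancels. *)

Require Import Defs.
From mathcomp Require Import all_boot all_order all_algebra all_field.
From mathcomp Require Import boolp reals complex.

Set Implicit Arguments.
Unset Strict Implicit.
Unset Printing Implicit Defensive.

Import GRing.Theory.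
Local Open Scope ring_scope.

(** [lin_mulmx A] is left multiplication by [A] on flattened matrices; its diagonal entry at the
    index [(a, b)] is [A a a] whatever [b] is. *)
Lemma mxtrace_lin_mulmx (F : comNzRingType) (n : nat) (A : 'M[F]_n) :
  \tr (lin_mulmx A : 'M_(n * n)) = \tr A *+ n.
Proof.
rewrite /mxtrace (reindex _ (curry_mxvec_bij _ _)) /=.
rewrite (eq_bigr (fun p : 'I_n * 'I_n => A p.1 p.1)); last first.
  case=> a b _ /=; rewrite !mxE /= mxvecE vec_mx_delta mxE (bigD1 a) //=.
  rewrite mxE !eqxx mulr1 big1 ?addr0 // => i /negPf ia.
  by rewrite mxE ia mulr0.
rewrite -(pair_bigA _ (fun i _ => A i i)) /= -sumrMnl.
by apply: eq_bigr => i _; rewrite sumr_const card_ord.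
Qed.

(** * Linear algebra over the center, up to central denominators *)

Section CenterModule.
Variables (k : fieldType) (A : algType k).
Local Notation Z := (center A).
Local Notation cmx := (map_mx (val : Z -> A)).

Lemma valC (z : Z) (r : A) : val z * r = r * val z.
Proof. exact: (in_centerP _ (valP z)). Qed.

Lemma valD (z w : Z) : val (z + w) = val z + val w.
Proof. exact: rmorphD. Qed.

Lemma valM (z w : Z) : val (z * w) = val z * val w.
Proof. exact: rmorphM. Qed.

Definition independent m (g : 'cV[A]_m) : Prop :=
  forall w : 'rV[Z]_m, cmx w *m g = 0 -> w = 0.

(** Over a prime [A], this is membership in the span of [g] over the fraction field of the center,
    with [z] as denominator. *)
Definition in_span m (g : 'cV[A]_m) (r : A) : Prop :=
  exists2 z : Z, z != 0 & exists w : 'rV[Z]_m, val z * r = (cmx w *m g) 0 0.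

Lemma independent_mx m (g : 'cV[A]_m) p (W : 'M[Z]_(p, m)) :
  independent g -> cmx W *m g = 0 -> W = 0.
Proof.
move=> indg Wg; apply/row_matrixP => i; rewrite row0; apply: indg.
by rewrite map_row -row_mul Wg row0.
Qed.

Hypothesis primeA : is_prime_ring A.

(** Since [z] is central, [val z * r = 0] forces [val z * s * r = 0] for every [s], and primeness
    applies. *)
Lemma center_mul_eq0 (z : Z) (r : A) : z != 0 -> val z * r = 0 -> r = 0.
Proof.
move=> z0 zr; have [s | z00 | //] := primeA (a := val z) (b := r).
  by rewrite valC -mulrA zr mulr0.
by case/eqP: z0; apply: val_inj; rewrite z00 raddf0.
Qed.

Lemma center_mul_neq0 (z w : Z) : z != 0 -> w != 0 -> z * w != 0.
Proof.
move=> z0; apply: contra_neq => zw; apply: val_inj; rewrite raddf0.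
by apply: (center_mul_eq0 z0); rewrite -rmorphM zw raddf0.
Qed.

Lemma in_span_col m (g : 'cV[A]_m) p (X : 'cV[A]_p) :
  (forall i, in_span g (X i 0)) ->
  exists2 z : Z, z != 0 & exists W : 'M[Z]_(p, m), val z *: X = cmx W *m g.
Proof.
move=> h; have /choice[z hz] i : exists z : Z, z != 0 /\
    exists w : 'rV[Z]_m, val z * X i 0 = (cmx w *m g) 0 0.
  by have [z z0 hz] := h i; exists z.
have z0 i : z i != 0 by case: (hz i).
have /choice[w hw] i := (hz i).2.
(* The product of all denominators is a common one; row [i] is rescaled by the other factors. *)
exists (\prod_i z i).
  apply: (big_ind (fun x => x != 0)) => //; first exact: oner_neq0.
  exact: center_mul_neq0.
exists (\matrix_i (\prod_(j | j != i) z j *: w i)).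
apply/matrixP => i j; rewrite ord1 !mxE.
have -> : \prod_l z l = (\prod_(l | l != i) z l) * z i.
  by rewrite (bigD1 i) //= mulrC.
rewrite rmorphM -mulrA hw.
rewrite mxE mulr_sumr; apply: eq_bigr => l _.
by rewrite !mxE rmorphM /= mulrA.
Qed.

(** In a nontrivial relation [z r + v g = 0] the coefficient [z] is nonzero, as otherwise [v = 0] by
    independence of [g]. *)
Lemma in_span_of_dependent m (g : 'cV[A]_m) (r : A) :
  independent g -> ~ independent (col_mx r%:M g) -> in_span g r.
Proof.
move=> indg dep; apply: contrapT => nspan; apply: dep => w.
rewrite -[w]hsubmxK map_row_mx mul_row_col.
move: (lsubmx w) (rsubmx w) => u v; rewrite [u]mx11_scalar.
move: (u 0 0) => z; rewrite map_scalar_mx -scalar_mxM => zv.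
have [z0 | z0] := eqVneq z 0.
  move: zv; rewrite z0 raddf0 mul0r raddf0 add0r => /indg ->.
  by rewrite raddf0 row_mx0.
case: nspan; exists z => //; exists (- v).
move/matrixP/(_ 0 0): zv; rewrite mxE !mxE eqxx mulr1n => /eqP.
rewrite addr_eq0 => /eqP ->; rewrite -sumrN; apply: eq_bigr => i _.
by rewrite !mxE raddfN mulNr.
Qed.

(** A largest independent subfamily of the module generators spans every generator up to
    denominators, hence all of [A]. *)
Lemma center_basis :
  is_finite_over_center A ->
  exists (m : nat) (g : 'cV[A]_m), independent g /\ forall r, in_span g r.
Proof.
case=> n [h genh].
pose P m := `[< exists f : 'I_m -> 'I_n, independent (\col_i h (f i)) >].
have P0 : exists m, P m.
  exists 0%N; apply/asboolP; exists (widen_ord (leq0n n)).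
  by move=> w _; apply/rowP; case.
have Ple m : P m -> (m <= n)%N.
  case/asboolP=> f indf; rewrite -(card_ord m) -(card_ord n).
  (* An independent selection is injective: if [f i = f j] with [i != j], the difference of two unit
     rows is a nonzero relation. *)
  apply: (leq_card f) => i j fij.
  apply: contrapT => /eqP/negPf nij.
  have /indf/rowP/(_ i)/eqP : cmx (delta_mx 0 i - delta_mx 0 j : 'rV[Z]_m)
      *m (\col_i h (f i)) = 0.
    rewrite map_mxB mulmxBl !map_delta_mx -!rowE.
    by apply/matrixP => a b; rewrite !mxE fij subrr.
  by rewrite !mxE !eqxx nij /= subr0 oner_eq0.
case: (ex_maxnP P0 Ple) => m /asboolP[f indf] maxm.
exists m, (\col_i h (f i)); split=> // r.
have spanh j : in_span (\col_i h (f i)) ((\col_j h j) j 0).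
  rewrite mxE; apply: in_span_of_dependent => // indj.
  suff /maxm : P m.+1 by rewrite ltnn.
  (* If [h j] were independent of the family, putting it in front would contradict maximality. *)
  apply/asboolP; exists (fun i =>
    if split (i : 'I_(1 + m)) is inr l then f l else j).
  rewrite (_ : \col__ _ = col_mx (h j)%:M (\col_i h (f i))) //.
  apply/matrixP => a b; rewrite !mxE; case: split => l; last by rewrite !mxE.
  by rewrite !ord1 mxE eqxx.
have [z z0 [W hW]] := in_span_col spanh; have [c ->] := genh r.
exists z => //; exists (\row_j c j *m W).
rewrite map_mxM -mulmxA -hW mulr_sumr mxE; apply: eq_bigr => j _.
by rewrite !mxE mulrA valC mulrA.
Qed.

(** * Comparison with the splitting matrix algebra *)

Section Splitting.
Variables (m : nat) (g : 'cV[A]_m).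
Hypotheses (indg : independent g) (spang : forall r, in_span g r).
Variables (Q : fieldType) (q : {rmorphism Z -> Q}) (injq : injective q).
Variables (F : fieldExtType Q) (n : nat) (phi : {rmorphism A -> 'M[F]_n.+1}).
Hypothesis splitphi : is_splitting q phi.

Lemma q_neq0 z : z != 0 -> q z != 0.
Proof. by move=> z0; rewrite -(rmorph0 q) (inj_eq injq). Qed.

(* [v] is the coordinate vector of [r] along [g] in the Q-space spanned by A,
   without constructing the localization of A. *)
Definition is_coord (r : A) (v : 'rV[Q]_m) : Prop :=
  exists2 z : Z, z != 0 & exists w : 'rV[Z]_m,
    val z * r = (cmx w *m g) 0 0 /\ q z *: v = map_mx q w.

Lemma is_coord_ex r : exists v, is_coord r v.
Proof.
have [z z0 [w hw]] := spang r; exists ((q z)^-1 *: map_mx q w).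
by exists z => //; exists w; rewrite scalerA divff ?q_neq0 // scale1r.
Qed.

Lemma map_center_scale_mulmx p (z : Z) (W : 'M[Z]_(p, m)) i j :
  (cmx (z *: W) *m g) i j = val z * (cmx W *m g) i j.
Proof. by rewrite map_mxZ -scalemxAl mxE. Qed.

(** Cross-multiplying by the two denominators reduces uniqueness to independence of [g]. *)
Lemma is_coord_inj r v v' : is_coord r v -> is_coord r v' -> v = v'.
Proof.
move=> [z z0 [w [zr zv]]] [z' z'0 [w' [zr' zv']]].
have : z' *: w = z *: w'.
  apply/eqP; rewrite -subr_eq0; apply/eqP/indg; rewrite map_mxB mulmxBl.
  apply/eqP; rewrite subr_eq0; apply/eqP/matrixP => i j.
  by rewrite !ord1 !map_center_scale_mulmx -zr -zr' !mulrA (valC z').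
move/(congr1 (map_mx q)); rewrite !map_mxZ -zv -zv' !scalerA mulrC.
by apply: scalerI; rewrite mulf_neq0 ?q_neq0.
Qed.

Lemma is_coordD r s u v :
  is_coord r u -> is_coord s v -> is_coord (r + s) (u + v).
Proof.
move=> [z z0 [w [zr zu]]] [z' z'0 [w' [zs zv]]].
exists (z * z'); first exact: center_mul_neq0.
exists (z' *: w + z *: w'); split.
  rewrite map_mxD mulmxDl [RHS]mxE !map_center_scale_mulmx -zr -zs.
  by rewrite !mulrA mulrDr rmorphM (valC z').
by rewrite map_mxD !map_mxZ -zu -zv !scalerA scalerDr rmorphM (mulrC (q z')).
Qed.

Lemma is_coordZ z r v : is_coord r v -> is_coord (val z * r) (q z *: v).
Proof.
move=> [z' z'0 [w [zr zv]]]; exists z' => //; exists (z *: w); split.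
  by rewrite map_center_scale_mulmx -zr !mulrA (valC z).
by rewrite map_mxZ -zv !scalerA mulrC.
Qed.

Lemma is_coord_delta i : is_coord (g i 0) (delta_mx 0 i).
Proof.
exists 1; first exact: oner_neq0.
exists (delta_mx 0 i); rewrite !map_delta_mx -rowE mxE !rmorph1.
by rewrite mul1r scale1r.
Qed.

Local Notation qF := (in_alg F \o q).

Lemma phiZ z r : phi (val z * r) = qF z *: phi r.
Proof.
case: splitphi => -[_ _ /(_ z r 1)] + _ /=.
by rewrite scale1r.
Qed.

(** Flattened images are stored as rows, so central coefficients act on the left and multiplication
    by elements of [A] acts on the right. *)
Definition phi_mx p (X : 'cV[A]_p) : 'M[F]_(p, n.+1 * n.+1) :=
  \matrix_i mxvec (phi (X i 0)).

Lemma phi_mxZ p a (X : 'cV[A]_p) :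
  phi_mx (a *: X) = phi_mx X *m lin_mulmx (phi a).
Proof.
apply/row_matrixP => i; rewrite row_mul !rowK mul_vec_lin /= mxE.
by rewrite rmorphM.
Qed.

Lemma phi_mxM p s (W : 'M[Z]_(p, s)) (X : 'cV[A]_s) :
  phi_mx (cmx W *m X) = map_mx qF W *m phi_mx X.
Proof.
apply/row_matrixP => i; rewrite rowK row_mul mulmx_sum_row mxE !raddf_sum /=.
by apply: eq_bigr => j _; rewrite rowK !mxE phiZ linearZ.
Qed.

(* The projection of the matrix algebra modulo the row space of [phi_mx g]
   vanishes on pure tensors, so it is zero by uniqueness in the universal
   property. *)
Lemma row_full_phi_mx : row_full (phi_mx g).
Proof.
set P := phi_mx g; rewrite -cokermx_eq0.
pose b (r : A) (f : F) : 'rV[F]_(n.+1 * n.+1) := 0.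
have bb : is_balanced (fun (z : Z) (r : A) => val z * r)
    (fun (z : Z) (f : F) => q z *: f) b.
  by split=> *; rewrite /b ?addr0.
have [h [_ uniqh]] := splitphi.2 _ b bb.
have Pphi r : mxvec (phi r) *m cokermx P = 0.
  have [z z0 [w hw]] := spang r.
  have : qF z *: mxvec (phi r) = map_mx qF w *m P.
    rewrite -phi_mxM -linearZ -phiZ hw; apply/row_matrixP => i.
    by rewrite !ord1 rowK row_id.
  move/(congr1 (mulmx^~ (cokermx P)))/eqP.
  rewrite -mulmxA mulmx_coker mulmx0 -scalemxAl scaler_eq0 fmorph_eq0.
  by rewrite (negPf (q_neq0 z0)) => /eqP.
have h1 := uniqh (mulmxr (cokermx P) \o mxvec : {additive _ -> _}).
have h0 := uniqh (\0 : {additive _ -> _}).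
apply/eqP/row_matrixP => i; rewrite row0 rowE.
rewrite -[delta_mx 0 i]vec_mxK.
rewrite [LHS]h1 => [|r f]; first by rewrite -h0.
by rewrite /= linearZ -scalemxAl Pphi scaler0.
Qed.

(* Coordinates along [g] define a balanced map to F^m, whose factorization
   through the tensor product separates the [phi (g i 0)]. *)
Lemma row_free_phi_mx : row_free (phi_mx g).
Proof.
have /choice[coord coordP] := is_coord_ex.
have coordE r v : is_coord r v -> coord r = v by exact: is_coord_inj.
pose b (r : A) (f : F) := f *: map_mx (in_alg F) (coord r).
have bb : is_balanced (fun (z : Z) (r : A) => val z * r)
    (fun (z : Z) (f : F) => q z *: f) b.
  rewrite /b; split=> [r s f|r f f'|z r f].
  - by rewrite (coordE _ _ (is_coordD (coordP r) (coordP s))) map_mxD scalerDr.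
  - exact: scalerDl.
  - rewrite (coordE _ _ (is_coordZ z (coordP r))) map_mxZ scalerA /=.
    by rewrite mulr_algr.
have [h [hb _]] := splitphi.2 _ b bb.
apply: inj_row_free => v; rewrite mulmx_sum_row => vP.
have /(congr1 h) : \sum_i v 0 i *: phi (g i 0) = 0.
  apply: (can_inj mxvecK); rewrite linear_sum linear0 -[RHS]vP.
  by apply: eq_bigr => i _; rewrite linearZ rowK.
rewrite raddf_sum raddf0 => <-; rewrite [LHS]row_sum_delta.
apply: eq_bigr => i _; rewrite hb /b (coordE _ _ (is_coord_delta i)).
by rewrite map_delta_mx.
Qed.

(** The images of [g] form an F-basis of the matrix algebra, so [phi_mx g] conjugates [M] into left
    multiplication by [phi a], whose trace is [n.+1] times that of [phi a]. *)
Lemma mxtrace_reduced (tr : A -> Z) a (M : 'M[Z]_m) :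
  (forall r, (q (tr r))%:A = \tr (phi r)) ->
  a *: g = cmx M *m g -> \tr M = tr a *+ n.+1.
Proof.
move=> trP aM; apply: injq; apply: (fmorph_inj (in_alg F)).
rewrite rmorphMn rmorphMn /= trP -mxtrace_lin_mulmx.
have := phi_mxM M g; rewrite -aM phi_mxZ => PL.
have [P' PP'] := row_freeP row_free_phi_mx.
(* [phi_mx g] is rectangular by type: its right inverse [P'] is two-sided because it equals the left
   inverse [B]. *)
have P'P : P' *m phi_mx g = 1%:M.
  have [B BP] := row_fullP row_full_phi_mx.
  by rewrite -[P']mul1mx -BP -(mulmxA B) PP' mulmx1.
rewrite -[LHS]/(qF _) -trace_map_mx -[map_mx _ M]mulmx1 -PP' mulmxA -PL.
by rewrite mxtrace_mulC mulmxA P'P mul1mx.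
Qed.

End Splitting.

End CenterModule.

(** * Linearity, symmetry and derivations of the reduced trace *)

Section ReducedTraceTheory.
Variables (k : fieldType) (A : algType k).
Local Notation Z := (center A).
Local Notation cmx := (map_mx (val : Z -> A)).
Variables (tr : A -> Z) (htr : is_reduced_trace tr).

(** The center embeds in [F] through [Q], so the identity may be checked on matrix traces. *)
Lemma reduced_trace_linear c r s : tr (val c * r + s) = c * tr r + tr s.
Proof.
case: htr => _ _ [Q [q [[injq _] _ [F [n [phi [sphi trP]]]]]]].
apply/injq/(fmorph_inj (in_alg F)).
rewrite /= trP rmorphD (phiZ sphi) linearD linearZ /= -!trP.
by rewrite rmorphD rmorphM scalerDl -scalerAl mul1r scalerA.
Qed.

Lemma reduced_trace_comm r s : tr (r * s) = tr (s * r).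
Proof.
case: htr => _ _ [Q [q [[injq _] _ [F [n [phi [sphi trP]]]]]]].
apply/injq/(fmorph_inj (in_alg F)).
by rewrite /= !trP !rmorphM; apply: mxtrace_mulC.
Qed.

Lemma map_center_mulmxZ p s t (W : 'M[Z]_(p, s)) a (X : 'M[A]_(s, t)) :
  cmx W *m (a *: X) = a *: (cmx W *m X).
Proof.
apply/matrixP => i j; rewrite !mxE mulr_sumr; apply: eq_bigr => l _.
by rewrite !mxE !mulrA valC.
Qed.

Lemma reduced_trace_derivation (delta : A -> A) (d : Z -> Z) :
  [pchar k] =i pred0 -> is_derivation delta ->
  (forall z, delta (val z) = val (d z)) ->
  forall r, tr (delta r) = d (tr r).
Proof.
move=> char0 [deltaL deltaM] dE r.
have deltaD x y : delta (x + y) = delta x + delta y.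
  by have := deltaL 1 x y; rewrite !scale1r.
have delta0 : delta 0 = 0 by apply: (addIr (delta 0)); rewrite -deltaD !add0r.
have dD : {morph d : x y / x + y}.
  by move=> x y; apply: val_inj; rewrite -dE !valD deltaD !dE.
have d0 : d 0 = 0 by apply: val_inj; rewrite -dE raddf0.
have dM x y : d (x * y) = d x * y + x * d y.
  by apply: val_inj; rewrite -dE valD !valM deltaM !dE.
case: (htr) => primeA fin [Q [q [[injq _] _ [F [n [phi [sphi trP]]]]]]].
have [m [g [indg spang]]] := center_basis primeA fin.
(* Stacking the three columns yields a single denominator [z]; the blocks of [W] are [M], [D] and
   [N]. *)
have [z z0 [W]] := in_span_col primeA
  (X := col_mx (r *: g) (col_mx (map_mx delta g) (delta r *: g)))
  (fun i => spang _).
rewrite -[W]vsubmxK -[dsubmx W]vsubmxK.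
move: (usubmx W) (usubmx (dsubmx W)) (dsubmx (dsubmx W)) => M D N.
rewrite !map_col_mx !mul_col_mx !scale_col_mx.
move=> /eq_col_mx[gM /eq_col_mx[gD gN]]; rewrite !scalerA in gM gN.
have deltaMx p s t (X : 'M[A]_(p, s)) (Y : 'M_(s, t)) :
    map_mx delta (X *m Y) = map_mx delta X *m Y + X *m map_mx delta Y.
  apply/matrixP => i j; rewrite !mxE (big_morph delta deltaD delta0) -big_split.
  by apply: eq_bigr => l _; rewrite !mxE deltaM.
(* The extra factor [z] allows [z delta(g)] to be replaced by [D g] on both sides. *)
have /(congr1 (fun X => val z *: X)) :
    delta (val z * r) *: g + (val z * r) *: map_mx delta g
    = cmx (map_mx d M) *m g + cmx M *m map_mx delta g.
  have -> : cmx (map_mx d M) = map_mx delta (cmx M).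
    by apply/matrixP => i j; rewrite !mxE -dE.
  rewrite -deltaMx -gM; apply/matrixP => i j.
  by rewrite !mxE -deltaM.
rewrite !scalerDr -!map_center_mulmxZ => hg.
have : d z *: M + z *: N + D *m M = z *: map_mx d M + M *m D.
  apply/eqP; rewrite -subr_eq0; apply/eqP; apply: (independent_mx indg).
  rewrite map_mxB mulmxBl !map_mxD !mulmxDl !map_mxZ !map_mxM.
  rewrite -!mulmxA -!scalemxAl.
  rewrite -gM -gN -gD -map_center_mulmxZ -hg map_center_mulmxZ -gD !scalerA.
  rewrite deltaM dE -scalerDl mulrDr !mulrA.
  by rewrite -(valC (d z) (val z)) -(valC z (val z * r)) !mulrA subrr.
have trE := mxtrace_reduced primeA indg spang injq sphi trP.
have trZ c s : tr (val c * s) = c * tr s.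
  have tr0 : tr 0 = 0.
    have := reduced_trace_linear 1 0 0; rewrite mulr0 mul1r addr0.
    by rewrite -[LHS]addr0 => /addrI.
  by have := reduced_trace_linear c s 0; rewrite !addr0 tr0 addr0.
move/(congr1 (fun X => \tr X)).
rewrite !mxtraceD !mxtraceZ (mxtrace_mulC D) => /addIr.
have -> : \tr (map_mx d M) = d (\tr M).
  rewrite /mxtrace (big_morph d dD d0).
  by apply: eq_bigr => i _; rewrite mxE.
have dMn x l : d (x *+ l) = d x *+ l.
  by elim: l => [|l IHl]; rewrite ?d0 // !mulrS dD IHl.
(* The terms in [d z * z * tr r] cancel, leaving [n.+1] times [z * (z * (tr (delta r) - d (tr r)))]
   equal to zero. *)
rewrite (trE _ _ gM) (trE _ _ gN) !trZ dMn dM !mulrnAr -mulrnDl mulrDr.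
rewrite mulrCA => /eqP; rewrite -subr_eq0 -mulrnBl opprD addrACA subrr add0r.
rewrite -!mulrBr -scaler_nat scaler_eq0 ((pcharf0P k).1 char0) /=.
apply: contraTeq; rewrite -subr_eq0 => tr0.
by do 2!apply: (center_mul_neq0 primeA) => //.
Qed.

End ReducedTraceTheory.

(** * The Poisson order of a specialization *)

Section SpecializationPoisson.
Variables (k : fieldType) (S : algType k) (T : specialization S).
Local Notation hN := (sp_hbar T ^+ sp_level T).

(** Regularity of [hbar] makes the quotient unique, so identities for [sp_der] become commutator
    identities in [T]. *)
Lemma sp_quot_eq c y w :
  hN * w = sp_iota T c * y - y * sp_iota T c -> sp_quot c y = w.
Proof. by rewrite -sp_quotE => /sp_hbarX_inj. Qed.

Lemma sp_der_derivation c : is_derivation (sp_der T c).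
Proof.
split=> [a x y|x y].
  have [s <-] := sp_theta_surj T x; have [t <-] := sp_theta_surj T y.
  rewrite -linearP !sp_derE -linearP; congr (sp_theta T _).
  apply: sp_quot_eq; rewrite mulrDr -scalerAr !sp_quotE.
  by rewrite mulrDr mulrDl -scalerAr -scalerAl scalerBr opprD addrACA.
have [s <-] := sp_theta_surj T x; have [t <-] := sp_theta_surj T y.
rewrite -rmorphM !sp_derE -!rmorphM -rmorphD; congr (sp_theta T _).
apply: sp_quot_eq; rewrite mulrDr mulrA sp_quotE (mulrA hN) sp_hbarX_central.
by rewrite -(mulrA s) sp_quotE mulrBl mulrBr !mulrA addrA subrK.
Qed.

Lemma sp_der_linear a c d r :
  sp_der T (a *: c + d) r = a *: sp_der T c r + sp_der T d r.
Proof.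
have [s <-] := sp_theta_surj T r; rewrite !sp_derE -linearP.
congr (sp_theta T _); apply: sp_quot_eq; rewrite mulrDr -scalerAr !sp_quotE.
by rewrite linearP mulrDl mulrDr -scalerAl -scalerAr scalerBr opprD addrACA.
Qed.

Lemma sp_bracket_self c : sp_bracket T c c = 0.
Proof.
(* The preimage [iota c] of [c] commutes with itself. *)
apply: val_inj; rewrite val_sp_bracket raddf0 -(sp_iotaK T c) sp_derE.
by rewrite (@sp_quot_eq _ _ 0) ?raddf0 // mulr0 subrr.
Qed.

Lemma sp_bracket_jacobi c d e :
  sp_bracket T c (sp_bracket T d e) + sp_bracket T d (sp_bracket T e c)
  + sp_bracket T e (sp_bracket T c d) = 0.
Proof.
apply: val_inj; rewrite !valD raddf0 !val_sp_bracket.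
rewrite -(sp_iotaK T c) -(sp_iotaK T d) -(sp_iotaK T e) !sp_derE -!raddfD.
(* Clearing both powers of [hbar] turns an iterated quotient into an iterated commutator, so the
   Jacobi identity of [T] applies. *)
have quot2 a b y : hN * (hN * sp_quot a (sp_quot b y)) =
    sp_iota T a * (sp_iota T b * y - y * sp_iota T b)
    - (sp_iota T b * y - y * sp_iota T b) * sp_iota T a :> T.
  rewrite sp_quotE -!(sp_quotE b y) mulrBr !mulrA.
  by rewrite (sp_hbarX_central _ (sp_iota T a)).
rewrite -[RHS](raddf0 (sp_theta T)); congr (sp_theta T _).
do 2!apply: (@sp_hbarX_inj _ _ T (sp_level T)); rewrite !mulr0 !mulrDr !quot2.
move: (sp_iota T c) (sp_iota T d) (sp_iota T e) => x y z.
rewrite !(mulrBr, mulrBl) !mulrA !opprB !addrA.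
(* The permutation pairs each of the twelve monomials with its opposite. *)
by rewrite [LHS](ACl ((1*12)*(7*2)*(3*10)*(5*4)*(11*6)*(9*8)))/= !subrr !addr0.
Qed.

Lemma sp_bracket_poisson : is_poisson_bracket (sp_bracket T).
Proof.
split; last exact: sp_bracket_jacobi.
- move=> c; have [derL derM] := sp_der_derivation c.
  split=> [a x y|x y]; apply: val_inj; rewrite val_sp_bracket.
    by rewrite [val (_ + _)]linearP derL -!val_sp_bracket -linearP.
  by rewrite valM derM -!val_sp_bracket -!valM -valD.
- move=> a c d e; apply: val_inj.
  by rewrite val_sp_bracket sp_der_linear -!val_sp_bracket -linearP.
- exact: sp_bracket_self.
Qed.

End SpecializationPoisson.

Theorem proposition5p3 (R : realType) (S : algType (complex R))
  (hS : sklyanin3_finite_order S \/ sklyanin4_finite_order S)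
  (tr_red : S -> center S) (htr : is_reduced_trace tr_red)
  (T : specialization S) :
  is_poisson_trace_order (sp_bracket T) (sp_der T) tr_red.
Proof.
split; [split | exact: reduced_trace_linear | exact: reduced_trace_comm |].
- exact: valC.
- by case: htr.
- exact: sp_bracket_poisson.
- by split; [exact: sp_der_derivation | exact: sp_der_linear].
- by move=> c d; rewrite val_sp_bracket.
(* [sp_der T c] is a derivation restricting to [sp_bracket T c] on the center, and [complex R] has
   characteristic 0. *)
- move=> c; apply: (reduced_trace_derivation htr (Num.Theory.pchar_num _)).
    exact: sp_der_derivation.
  by move=> z; rewrite val_sp_bracket.
Qed.
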